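(* Let $A\in\mathbb{R}^{m\times n}$, $d\in\mathbb{R}^m$, $\Psi\in\mathbb{R}^{r\times n}$, let $\lambda>0$ and $\epsilon>0$ be fixed, and let $$\mathcal{J}_{\epsilon,\lambda}(x)=\tfrac12\|Ax-d\|_2^2+\lambda\sum_{j=1}^{r}\phi_\epsilon\big((\Psi x)_j\big),\qquad \phi_\epsilon(t)=\sqrt{t^2+\epsilon^2}.$$ Let $(x^{(k)})_{k\ge 1}$ be a sequence in $\mathbb{R}^n$ such that for every $k\ge1$ the iterate $x^{(k+1)}$ is a minimizer of the quadratic tangent majorant $x\mapsto\mathcal{Q}(x,x^{(k)})$ of $\mathcal{J}_{\epsilon,\lambda}$ at $x^{(k)}$ over a linear subspace $S_k\subseteq\mathbb{R}^n$ (the search space at step $k$) that contains both the current iterate $x^{(k)}$ and the gradient $r^{(k)}=\nabla_x\mathcal{Q}(x^{(k)},x^{(k)})$. Then $$\lim_{k\to\infty}\nabla_x\mathcal{J}_{\epsilon,\lambda}(x^{(k)})=0 .$$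
   Context: For an iterate $x^{(k)}\in\mathbb{R}^n$ put $u^{(k)}=\Psi x^{(k)}\in\mathbb{R}^r$, let $w_\epsilon^{(k)}\in\mathbb{R}^r$ have entries $\big((u_j^{(k)})^2+\epsilon^2\big)^{-1/2}$, and let $P_\epsilon^{(k)}=(\mathrm{diag}(w_\epsilon^{(k)}))^{1/2}$. The quadratic tangent majorant of $\mathcal{J}_{\epsilon,\lambda}$ at $x^{(k)}$ is $$\mathcal{Q}(x,x^{(k)})=\tfrac12\|Ax-d\|_2^2+\tfrac{\lambda}{2}\|P_\epsilon^{(k)}\Psi x\|_2^2+c_k,$$ where the constant $c_k$, independent of $x$, is chosen so that $\mathcal{Q}(x^{(k)},x^{(k)})=\mathcal{J}_{\epsilon,\lambda}(x^{(k)})$. The gradient $\nabla_x\mathcal{Q}(x^{(k)},x^{(k)})$ is taken with respect to the first argument, so $r^{(k)}=\big(A^TA+\lambda\Psi^T(P_\epsilon^{(k)})^2\Psi\big)x^{(k)}-A^Td$. The search spaces $S_k$ are those of an algorithm (LM-MM-GKS) that alternates between enlarging the search space, replacing the previous search space by its sum with $\mathrm{span}\{r^{(k)}\}$, and compressing it to a lower-dimensional subspace that retains $x^{(k)}$ and $r^{(k)}$; in all cases $S_k$ contains $x^{(k)}$ and $r^{(k)}$. *)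

(* Defs.v *)
From HB Require Import structures.
From mathcomp Require Import all_boot all_order all_algebra.
From mathcomp Require Import all_classical all_reals all_analysis.
Set Implicit Arguments.
Unset Strict Implicit.
Unset Printing Implicit Defensive.
Import Order.TTheory GRing.Theory Num.Theory.
Import numFieldNormedType.Exports.
Local Open Scope classical_set_scope.
Local Open Scope ring_scope.

(* The norm `|v| that the library puts on matrices is the sup norm, hence this
   separate Euclidean norm. The two induce the same topology on 'cV[R]_n. *)
Definition norm2 (R : realType) (n : nat) (v : 'cV[R]_n) : R :=
  Num.sqrt (\sum_(i < n) v i 0 ^+ 2).

(* 'D_v f x is a total operator, meaningful only where the directional
   derivative exists; below it is applied to functions that are differentiable
   everywhere. *)
Definition gradient (R : realType) (n : nat) (f : 'cV[R]_n -> R)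
    (x : 'cV[R]_n) : 'cV[R]_n :=
  \col_(i < n) 'D_(delta_mx i 0) (f : 'cV[R]_n -> R^o) x.

Definition is_minimizer_on (R : realType) (n : nat) (f : 'cV[R]_n -> R)
    (S : {vspace 'cV[R]_n}) (x : 'cV[R]_n) : Prop :=
  x \in S /\ forall y : 'cV[R]_n, y \in S -> f x <= f y.

Definition phi (R : realType) (eps t : R) : R := Num.sqrt (t ^+ 2 + eps ^+ 2).

Definition objective (R : realType) (m n r : nat) (A : 'M[R]_(m, n))
    (d : 'cV[R]_m) (Psi : 'M[R]_(r, n)) (eps lambda : R) (x : 'cV[R]_n) : R :=
  2^-1 * norm2 (A *m x - d) ^+ 2
  + lambda * \sum_(j < r) phi eps ((Psi *m x) j 0).

Definition weights (R : realType) (n r : nat) (Psi : 'M[R]_(r, n)) (eps : R)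
    (xk : 'cV[R]_n) : 'cV[R]_r :=
  \col_(j < r) (Num.sqrt ((Psi *m xk) j 0 ^+ 2 + eps ^+ 2))^-1.

(* The square root of the diagonal matrix diag(w), for w with nonnegative
   entries. *)
Definition weight_mx (R : realType) (n r : nat) (Psi : 'M[R]_(r, n)) (eps : R)
    (xk : 'cV[R]_n) : 'M[R]_r :=
  diag_mx (map_mx Num.sqrt (weights Psi eps xk))^T.

Definition majorant_quad (R : realType) (m n r : nat) (A : 'M[R]_(m, n))
    (d : 'cV[R]_m) (Psi : 'M[R]_(r, n)) (eps lambda : R)
    (x xk : 'cV[R]_n) : R :=
  2^-1 * norm2 (A *m x - d) ^+ 2
  + lambda / 2 * norm2 (weight_mx Psi eps xk *m (Psi *m x)) ^+ 2.

(* The unique constant for which the majorant touches the objective at xk. *)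
Definition majorant_const (R : realType) (m n r : nat) (A : 'M[R]_(m, n))
    (d : 'cV[R]_m) (Psi : 'M[R]_(r, n)) (eps lambda : R)
    (xk : 'cV[R]_n) : R :=
  objective A d Psi eps lambda xk - majorant_quad A d Psi eps lambda xk xk.

Definition majorant (R : realType) (m n r : nat) (A : 'M[R]_(m, n))
    (d : 'cV[R]_m) (Psi : 'M[R]_(r, n)) (eps lambda : R)
    (x xk : 'cV[R]_n) : R :=
  majorant_quad A d Psi eps lambda x xk + majorant_const A d Psi eps lambda xk.

(* Main.v *)
Require Import Defs.
From HB Require Import structures.
From mathcomp Require Import all_boot all_order all_algebra.
From mathcomp Require Import all_classical all_reals all_analysis.
From mathcomp Require Import ring lra.
Set Implicit Arguments.
Unset Strict Implicit.
Unset Printing Implicit Defensive.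
Import Order.TTheory GRing.Theory Num.Theory.
Import numFieldNormedType.Exports.
Local Open Scope classical_set_scope.
Local Open Scope ring_scope.

(** The argument is a majorize-minimize descent estimate for the objective J.

    At every x the majorant Q(., x) is exactly quadratic,
      Q (x + h v, x) = J x + h <v, g> + h^2 / 2 * c(v)
    (majorant_expansion), with g the explicit vector majorant_gradient. The
    function phi_eps is concave as a function of t^2 and convex as a function
    of t, so J lies below Q(., x) (objective_le_majorant) and above the affine
    function v |-> J x + <v, g> (objective_ge_linear). A function squeezed in
    this way between two functions that differ by O(h^2) has gradient g, so J
    and Q(., x) have the same gradient g at x (gradient_objective,
    gradient_majorant).

    The weights are at most 1/eps, whence c(v) <= L |v|^2 with L independent of
    x (curvature_bound). The subspace S_k contains the steepest descent point
    x_k - g_k / L, and comparing the minimizer x_(k+1) with it gives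
      |g_k|^2 <= 2 L (J x_k - J x_(k+1))
    (sufficient_decrease). So J is nonincreasing along the iterates and bounded
    below by 0; its successive differences tend to 0, and g_k with them. *)

(** * The Euclidean inner product on column vectors *)

Definition dotmx (R : realType) (n : nat) (u v : 'cV[R]_n) : R :=
  (u^T *m v) 0 0.

Section InnerProduct.
Variable R : realType.

Lemma dotmxE n (u v : 'cV[R]_n) : dotmx u v = \sum_i u i 0 * v i 0.
Proof. by rewrite /dotmx mxE; apply: eq_bigr => i _; rewrite mxE. Qed.

Lemma norm2_sqr n (v : 'cV[R]_n) : norm2 v ^+ 2 = \sum_i v i 0 ^+ 2.
Proof. by rewrite /norm2 sqr_sqrtr // sumr_ge0 // => i _; rewrite sqr_ge0. Qed.

Lemma dotmx_norm2 n (v : 'cV[R]_n) : dotmx v v = norm2 v ^+ 2.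
Proof. by rewrite dotmxE norm2_sqr; apply: eq_bigr => i _; rewrite expr2. Qed.

Lemma dotmxDr n (v a b : 'cV[R]_n) : dotmx v (a + b) = dotmx v a + dotmx v b.
Proof. by rewrite /dotmx mulmxDr mxE. Qed.

Lemma dotmxZr n c (v a : 'cV[R]_n) : dotmx v (c *: a) = c * dotmx v a.
Proof. by rewrite /dotmx -scalemxAr mxE. Qed.

Lemma dotmxZl n c (v a : 'cV[R]_n) : dotmx (c *: v) a = c * dotmx v a.
Proof. by rewrite /dotmx linearZ -scalemxAl mxE. Qed.

Lemma dotmx_adjoint m n (A : 'M[R]_(m, n)) (v : 'cV[R]_n) (u : 'cV[R]_m) :
  dotmx v (A^T *m u) = dotmx (A *m v) u.
Proof. by rewrite /dotmx trmx_mul mulmxA. Qed.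

Lemma dotmx_delta n (i : 'I_n) (v : 'cV[R]_n) :
  dotmx (delta_mx i 0) v = v i 0.
Proof.
rewrite dotmxE (bigD1 i) //= big1 => [|j ji]; last by rewrite mxE (negPf ji) mul0r.
by rewrite mxE !eqxx mul1r addr0.
Qed.

Lemma norm2_sqrDZ n (u v : 'cV[R]_n) (h : R) :
  norm2 (u + h *: v) ^+ 2
  = norm2 u ^+ 2 + 2 * h * dotmx v u + h ^+ 2 * norm2 v ^+ 2.
Proof.
rewrite !norm2_sqr dotmxE !mulr_sumr -!big_split /=.
by apply: eq_bigr => i _; rewrite !mxE; ring.
Qed.

Lemma norm_le_norm2 n (v : 'cV[R]_n) (i : 'I_n) : `|v i 0| <= norm2 v.
Proof.
rewrite -sqrtr_sqr /norm2 ler_wsqrtr // (bigD1 i) //= lerDl.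
by rewrite sumr_ge0 // => j _; rewrite sqr_ge0.
Qed.

(** Convergence of vectors refers to the sup norm, so this is what turns decay
    of the Euclidean norm into a limit. *)
Lemma mx_norm_le_norm2 n (v : 'cV[R]_n) : `|v| <= norm2 v.
Proof.
rewrite [`|v|]mx_normrE; apply/bigmax_leP; split; first exact: sqrtr_ge0.
by case=> i j _; rewrite /= (ord1 j) norm_le_norm2.
Qed.

(** Every entry of v is at most |v|, so row i of A *m v is at most |v| times
    the l1 norm of row i of A. *)
Lemma mulmx_norm2_bound m n (A : 'M[R]_(m, n)) :
  exists2 L, 0 <= L & forall v, norm2 (A *m v) ^+ 2 <= L * norm2 v ^+ 2.
Proof.
exists (\sum_i (\sum_j `|A i j|) ^+ 2) => [|v].
  by apply: sumr_ge0 => i _; rewrite sqr_ge0.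
rewrite norm2_sqr mulr_suml; apply: ler_sum => i _.
rewrite -exprMn -[leLHS]real_normK ?num_real //.
have S0 : 0 <= \sum_j `|A i j| by exact: sumr_ge0.
have v0 : 0 <= norm2 v by exact: sqrtr_ge0.
rewrite ler_sqr ?nnegrE ?mulr_ge0 // mxE mulr_suml.
apply: le_trans (ler_norm_sum _ _ _) _; apply: ler_sum => j _.
by rewrite normrM ler_wpM2l // norm_le_norm2.
Qed.

End InnerProduct.

(** * Quadratic upper and affine lower bounds for phi *)

Section Phi.
Variables (R : realType) (eps : R).
Hypothesis eps0 : 0 < eps.

Lemma sqr_phi t : phi eps t ^+ 2 = t ^+ 2 + eps ^+ 2.
Proof. by rewrite sqr_sqrtr // addr_ge0 // sqr_ge0. Qed.

Lemma phi_ge_eps t : eps <= phi eps t.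
Proof.
by rewrite -[leLHS]gtr0_norm // -sqrtr_sqr ler_wsqrtr // lerDr sqr_ge0.
Qed.

Lemma phi_gt0 t : 0 < phi eps t.
Proof. exact: lt_le_trans eps0 (phi_ge_eps t). Qed.

(** Concavity of the square root: with a = phi t and b = phi (t + s), the claim
    is b <= a + (b^2 - a^2) / (2 a), that is 0 <= (a - b)^2. *)
Lemma phi_le_tangent_quadratic t s :
  phi eps (t + s) <= phi eps t + t * s / phi eps t + s ^+ 2 / (2 * phi eps t).
Proof.
have a0 := phi_gt0 t; have := sqr_phi t; have := sqr_phi (t + s).
move: (phi eps t) (phi eps (t + s)) a0 => a b a0 b2 a2.
have -> : a + t * s / a + s ^+ 2 / (2 * a)
        = (2 * a ^+ 2 + 2 * t * s + s ^+ 2) / (2 * a).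
  by field; rewrite gt_eqF.
rewrite ler_pdivlMr ?mulr_gt0 //.
have := sqr_ge0 (a - b); nra.
Qed.

(** Convexity of phi: after multiplication by phi t this is the Cauchy-Schwarz
    inequality for the vectors (t, eps) and (t + s, eps). *)
Lemma phi_ge_tangent_line t s :
  phi eps t + t * s / phi eps t <= phi eps (t + s).
Proof.
have a0 := phi_gt0 t; have b0 := phi_gt0 (t + s).
have := sqr_phi t; have := sqr_phi (t + s).
move: (phi eps t) (phi eps (t + s)) a0 b0 => a b a0 b0 b2 a2.
have -> : a + t * s / a = (a ^+ 2 + t * s) / a by field; rewrite gt_eqF.
rewrite ler_pdivrMr // a2.
apply: le_trans (ler_norm _) _.
rewrite -ler_sqr ?nnegrE ?mulr_ge0 ?(ltW a0) ?(ltW b0) //.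
rewrite real_normK ?num_real // exprMn b2 a2.
have := sqr_ge0 (eps * s); lra.
Qed.

End Phi.

(** * Gradients read off from quadratic bounds *)

Section Derivative.
Variable R : realType.

(** The difference quotient at h differs from c by at most |h| K. *)
Lemma derive_quadratic_sandwich n (f : 'cV[R]_n -> R) (x v : 'cV[R]_n)
    (c K : R) :
  (forall h, f x + h * c <= f (x + h *: v) <= f x + h * c + h ^+ 2 * K) ->
  'D_v (f : 'cV[R]_n -> R^o) x = c.
Proof.
move=> fxh.
have K0 : 0 <= K.
  (* the two bounds at h = 1 *)
  have /andP[] := fxh 1; lra.
apply: cvg_lim => //.
apply/cvgrPdist_le => e e0; near=> h.
have h0 : h != 0 by near: h; exact: nbhs_dnbhs_neq.
have hs : `|h| * K <= e.
  (* K + 1 rather than K, since K may be 0 *)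
  have hs1 : `|h| <= e / (K + 1).
    near: h; apply: dnbhs0_le; rewrite divr_gt0 //; lra.
  apply: le_trans (_ : `|h| * (K + 1) <= e); first by rewrite ler_wpM2l //; lra.
  by rewrite -ler_pdivlMr //; lra.
have /andP[lo hi] := fxh h.
rewrite /= [h *: v + x]addrC.
have -> : c - h^-1 *: (f (x + h *: v) - f x)
        = - ((f (x + h *: v) - f x - h * c) / h).
  by rewrite /GRing.scale /=; field.
rewrite normrN normrM normfV ler_pdivrMr ?normr_gt0 //.
rewrite ger0_norm; last lra.
apply: le_trans (_ : h ^+ 2 * K <= _); first lra.
rewrite -real_normK ?num_real // expr2 mulrAC.
by rewrite ler_wpM2r.
Unshelve. all: by end_near. Qed.

Lemma gradient_quadratic_sandwich n (f : 'cV[R]_n -> R) (x g : 'cV[R]_n)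
    (K : 'cV[R]_n -> R) :
  (forall v h,
    f x + h * dotmx v g <= f (x + h *: v) <= f x + h * dotmx v g + h ^+ 2 * K v) ->
  gradient f x = g.
Proof.
move=> fxh; apply/colP => i; rewrite mxE.
by rewrite (derive_quadratic_sandwich (fxh _)) dotmx_delta.
Qed.

End Derivative.

(** * The quadratic majorant and the descent estimate *)

(** The residual $A^T(Ax-d)+\lambda\Psi^TP^2\Psi x$ of the normal equations,
    grouped around the single matrix $B=P\Psi$ so that its inner product with a
    vector v is a combination of inner products with A v and B v. *)
Definition majorant_gradient (R : realType) (m n r : nat) (A : 'M[R]_(m, n))
    (d : 'cV[R]_m) (Psi : 'M[R]_(r, n)) (eps lambda : R) (x : 'cV[R]_n) :
    'cV[R]_n :=
  let B := weight_mx Psi eps x *m Psi in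
  A^T *m (A *m x - d) + lambda *: (B^T *m (B *m x)).

Definition majorant_curvature (R : realType) (m n r : nat) (A : 'M[R]_(m, n))
    (Psi : 'M[R]_(r, n)) (eps lambda : R) (x v : 'cV[R]_n) : R :=
  norm2 (A *m v) ^+ 2 + lambda * norm2 (weight_mx Psi eps x *m Psi *m v) ^+ 2.

Section Majorant.
Variables (R : realType) (m n r : nat) (A : 'M[R]_(m, n)) (d : 'cV[R]_m).
Variables (Psi : 'M[R]_(r, n)) (lambda eps : R).
Hypotheses (lambda0 : 0 < lambda) (eps0 : 0 < eps).
Implicit Types (u v x y : 'cV[R]_n).

Local Notation J := (objective A d Psi eps lambda).
Local Notation Q := (majorant A d Psi eps lambda).
Local Notation g := (majorant_gradient A d Psi eps lambda).
Local Notation curv := (majorant_curvature A Psi eps lambda).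
Local Notation B x := (weight_mx Psi eps x *m Psi).

Lemma weighted_coord x v j :
  (B x *m v) j 0 = Num.sqrt (phi eps ((Psi *m x) j 0))^-1 * (Psi *m v) j 0.
Proof. by rewrite -mulmxA mul_diag_mx !mxE. Qed.

Lemma dotmx_weighted x u v :
  dotmx (B x *m u) (B x *m v)
  = \sum_j (Psi *m u) j 0 * (Psi *m v) j 0 / phi eps ((Psi *m x) j 0).
Proof.
rewrite dotmxE; apply: eq_bigr => j _; rewrite !weighted_coord.
have : 0 <= (phi eps ((Psi *m x) j 0))^-1 by rewrite invr_ge0 ltW // phi_gt0.
move=> /sqr_sqrtr w2; rewrite -[in RHS]w2; ring.
Qed.

(** The constant of the majorant is chosen so that the term of order 0 is the
    objective itself. *)
Lemma majorant_expansion x v h :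
  Q (x + h *: v) x = J x + h * dotmx v (g x) + h ^+ 2 * (2^-1 * curv x v).
Proof.
rewrite /majorant /majorant_const /majorant_quad /majorant_gradient.
rewrite /majorant_curvature dotmxDr dotmxZr !dotmx_adjoint !mulmxA.
have -> : A *m (x + h *: v) - d = (A *m x - d) + h *: (A *m v).
  by rewrite mulmxDr -scalemxAr addrAC.
rewrite mulmxDr -scalemxAr !norm2_sqrDZ.
move: (J x) (dotmx (A *m v) _) (dotmx (B x *m v) _) => a b c.
by field.
Qed.

Lemma objective_expansion_data x v :
  2^-1 * norm2 (A *m (x + v) - d) ^+ 2
  = 2^-1 * norm2 (A *m x - d) ^+ 2 + dotmx v (A^T *m (A *m x - d))
    + 2^-1 * norm2 (A *m v) ^+ 2.
Proof.
have -> : A *m (x + v) - d = (A *m x - d) + 1 *: (A *m v).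
  by rewrite mulmxDr scale1r addrAC.
by rewrite norm2_sqrDZ dotmx_adjoint; field.
Qed.

(** The data terms of both sides coincide, so only the penalties have to be
    compared, coordinate by coordinate, by phi_le_tangent_quadratic. *)
Lemma objective_le_majorant x v : J (x + v) <= Q (x + v) x.
Proof.
rewrite -[v in leRHS]scale1r majorant_expansion /objective.
rewrite objective_expansion_data /majorant_gradient /majorant_curvature.
rewrite dotmxDr dotmxZr !dotmx_adjoint -!dotmx_norm2 !dotmx_weighted.
have H : \sum_j phi eps ((Psi *m (x + v)) j 0)
  <= \sum_j phi eps ((Psi *m x) j 0)
   + \sum_j (Psi *m v) j 0 * (Psi *m x) j 0 / phi eps ((Psi *m x) j 0)
   + 2^-1 * \sum_j (Psi *m v) j 0 * (Psi *m v) j 0 / phi eps ((Psi *m x) j 0).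
  rewrite mulr_sumr -!big_split /=; apply: ler_sum => j _.
  rewrite mulmxDr [in leLHS]mxE.
  apply: le_trans (phi_le_tangent_quadratic eps0 _ _) _.
  rewrite le_eqVlt; apply/orP; left; apply/eqP.
  by field; rewrite gt_eqF // phi_gt0.
have := ler_wpM2l (ltW lambda0) H.
rewrite !mulrDr; lra.
Qed.

(** The affine function is the tangent of the convex function J at x; the data
    term has the nonnegative slack |A v|^2 / 2. *)
Lemma objective_ge_linear x v : J x + dotmx v (g x) <= J (x + v).
Proof.
rewrite /objective objective_expansion_data /majorant_gradient.
rewrite dotmxDr dotmxZr !dotmx_adjoint !dotmx_weighted.
have H : \sum_j phi eps ((Psi *m x) j 0)
   + \sum_j (Psi *m v) j 0 * (Psi *m x) j 0 / phi eps ((Psi *m x) j 0)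
  <= \sum_j phi eps ((Psi *m (x + v)) j 0).
  rewrite -!big_split /=; apply: ler_sum => j _.
  rewrite mulmxDr [in leRHS]mxE [_ * (Psi *m x) j 0]mulrC.
  exact: phi_ge_tangent_line.
have := ler_wpM2l (ltW lambda0) H.
have := sqr_ge0 (norm2 (A *m v)).
rewrite !mulrDr; lra.
Qed.

(** The upper bound of the sandwich is the majorant, and the lower one is the
    tangent. *)
Lemma gradient_objective x : gradient J x = g x.
Proof.
apply: (gradient_quadratic_sandwich (K := fun v => 2^-1 * curv x v)) => v h.
rewrite -majorant_expansion objective_le_majorant andbT.
by rewrite -dotmxZl objective_ge_linear.
Qed.

Lemma curvature_ge0 x v : 0 <= curv x v.
Proof. by rewrite addr_ge0 ?sqr_ge0 // mulr_ge0 ?sqr_ge0 // ltW. Qed.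

Lemma majorant_touch x : Q x x = J x.
Proof. by rewrite /majorant /majorant_const addrC subrK. Qed.

(** The hypothesis on the search spaces speaks of the gradient of the majorant;
    this identifies it with the gradient of the objective. *)
Lemma gradient_majorant x : gradient (Q^~ x) x = g x.
Proof.
apply: (gradient_quadratic_sandwich (K := fun v => 2^-1 * curv x v)) => v h.
rewrite /= majorant_expansion majorant_touch lexx andbT.
rewrite lerDl mulr_ge0 ?sqr_ge0 // mulr_ge0 ?invr_ge0 //; exact: curvature_ge0.
Qed.

(** Since phi >= eps, every weight is at most 1/eps, which makes L uniform in x.
    Adding 1 to the constant keeps L positive even if A and Psi vanish, so
    that the step length 1/L makes sense. *)
Lemma curvature_bound :
  exists2 L, 0 < L & forall x v, curv x v <= L * norm2 v ^+ 2.
Proof.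
have [a a0 Aa] := mulmx_norm2_bound A.
have [b b0 Pb] := mulmx_norm2_bound Psi.
have c0 : 0 <= lambda / eps * b.
  by rewrite mulr_ge0 // divr_ge0 // ltW.
exists (a + lambda / eps * b + 1) => [|x v]; first lra.
rewrite /majorant_curvature.
have H : norm2 (B x *m v) ^+ 2 <= eps^-1 * (b * norm2 v ^+ 2).
  apply: le_trans (_ : eps^-1 * norm2 (Psi *m v) ^+ 2 <= _); last first.
    by rewrite ler_wpM2l // invr_ge0 ltW.
  rewrite -dotmx_norm2 dotmx_weighted norm2_sqr mulr_sumr.
  apply: ler_sum => j _; rewrite -expr2 mulrC ler_wpM2r ?sqr_ge0 //.
  by rewrite lef_pV2 ?posrE ?phi_gt0 // phi_ge_eps.
have := ler_wpM2l (ltW lambda0) H; have := Aa v; have := sqr_ge0 (norm2 v).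
rewrite !mulrA !mulrDl mul1r; lra.
Qed.

Lemma objective_ge0 x : 0 <= J x.
Proof.
apply: addr_ge0; first by rewrite mulr_ge0 ?sqr_ge0 ?invr_ge0.
by rewrite mulr_ge0 ?(ltW lambda0) // sumr_ge0 // => j _; exact: sqrtr_ge0.
Qed.

(** The point x - g / L minimizes the upper bound
    J x - t |g|^2 + t^2 L |g|^2 / 2 of the majorant along the ray x - t g. It
    lies in S, so the minimizer y does at least as well. *)
Lemma sufficient_decrease (S : {vspace 'cV[R]_n}) x y L :
    0 < L -> (forall v, curv x v <= L * norm2 v ^+ 2) ->
    x \in S -> g x \in S -> is_minimizer_on (Q^~ x) S y ->
  norm2 (g x) ^+ 2 <= 2 * L * (J x - J y).
Proof.
move=> L0 Lcurv xS gS [yS ymin].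
have zS : x + - L^-1 *: g x \in S by rewrite rpredD // rpredZ.
have Jy : J y <= Q y x.
  by have := objective_le_majorant x (y - x); rewrite addrC subrK.
have half0 : 0 <= L^-1 ^+ 2 / 2 by rewrite divr_ge0 ?sqr_ge0.
rewrite -ler_pdivrMl ?mulr_gt0 // [leLHS]mulrC.
have := ler_wpM2l half0 (Lcurv (g x)); have := ymin _ zS.
rewrite majorant_expansion dotmx_norm2 sqrrN mulNr [_ ^+ 2 * (_ * _)]mulrA.
have -> : L^-1 ^+ 2 / 2 * (L * norm2 (g x) ^+ 2) = norm2 (g x) ^+ 2 / (2 * L).
  by field; rewrite gt_eqF.
have -> : L^-1 * norm2 (g x) ^+ 2 = 2 * (norm2 (g x) ^+ 2 / (2 * L)).
  by field; rewrite gt_eqF.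
lra.
Qed.

End Majorant.

(** * Convergence to zero *)

Lemma cvg_diff_nonincreasing (R : realType) (u : nat -> R) :
  (forall k, (1 <= k)%N -> u k.+1 <= u k) -> (forall k, 0 <= u k) ->
  (fun k => u k - u k.+1) @ \oo --> (0 : R).
Proof.
move=> udec u0.
(* The shifted sequence is nonincreasing from its first index on. *)
have ucvg : cvgn (fun k => u k.+1).
  apply: nonincreasing_is_cvgn.
    by apply/nonincreasing_seqP => k; exact: udec.
  by exists 0 => _ [k _ <-].
have u1 : u k @[k --> \oo] --> limn (fun k => u k.+1).
  by rewrite -cvg_shiftS.
rewrite -(subrr (limn (fun k => u k.+1))).
by apply: cvgB.
Qed.

Theorem theorem1 (R : realType) (m n r : nat) (A : 'M[R]_(m, n))
    (d : 'cV[R]_m) (Psi : 'M[R]_(r, n)) (lambda eps : R)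
    (hlambda : 0 < lambda) (heps : 0 < eps)
    (x : nat -> 'cV[R]_n) (S : nat -> {vspace 'cV[R]_n})
    (hx : forall k : nat, (1 <= k)%N -> x k \in S k)
    (hr : forall k : nat, (1 <= k)%N ->
      gradient (fun y : 'cV[R]_n => majorant A d Psi eps lambda y (x k)) (x k)
        \in S k)
    (hmin : forall k : nat, (1 <= k)%N ->
      is_minimizer_on
        (fun y : 'cV[R]_n => majorant A d Psi eps lambda y (x k))
        (S k) (x k.+1)) :
  (fun k : nat => gradient (objective A d Psi eps lambda) (x k)) @ \oo
    --> (0 : 'cV[R]_n).
Proof.
have [L L0 Lcurv] := curvature_bound A Psi hlambda heps.
set J := objective A d Psi eps lambda.
have dec k : (1 <= k)%N ->
    norm2 (gradient J (x k)) ^+ 2 <= 2 * L * (J (x k) - J (x k.+1)).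
  move=> k1; rewrite gradient_objective //.
  apply: sufficient_decrease (hmin k k1) => //; first exact: hx.
  by rewrite -gradient_majorant //; exact: hr.
have L2 : 0 < 2 * L by rewrite mulr_gt0.
have /cvgrPdist_lt Jdiff : (fun k => J (x k) - J (x k.+1)) @ \oo --> (0 : R).
  apply: (cvg_diff_nonincreasing (u := J \o x)) => [k k1|k].
    rewrite -subr_ge0 -(pmulr_rge0 _ L2) /=.
    by apply: le_trans (dec k k1); exact: sqr_ge0.
  exact: objective_ge0.
apply/cvgrPdist_lt => e e0; near=> k.
rewrite sub0r normrN; apply: le_lt_trans (mx_norm_le_norm2 _) _.
rewrite -ltr_sqr ?nnegrE ?sqrtr_ge0 ?(ltW e0) //.
apply: le_lt_trans (dec k _) _; first by near: k; exact: nbhs_infty_ge.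
rewrite mulrC -ltr_pdivlMr //.
apply: le_lt_trans (ler_norm _) _; rewrite -normrN -sub0r.
near: k; apply: Jdiff.
by rewrite divr_gt0 // exprn_gt0.
Unshelve. all: by end_near. Qed.
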